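(* Consider the SLC problem with $m$ identical machines, $n$ jobs and a single linear constraint $\sum_{i=1}^n a_i x_i\ge b$, $\bm{x}\ge 0$, where $a_1\ge a_2\ge\cdots\ge a_n$, $b\ge 0$, and at least one $a_i>0$. Let $n'=\min\{\max\{i : a_i>0\},\, m\}$ and $\sigma=\sum_{i=1}^{n'}a_i$. Then an optimal solution is given by the processing times $x_1=\cdots=x_{n'}=b/\sigma$ and $x_i=0$ for $i>n'$, and the optimal makespan is $b/\sigma$.
   Context: The SLC problem: there are $m$ identical parallel machines and $n$ jobs. The processing times $\bm{x}=(x_1,\ldots,x_n)$ are decision variables and must satisfy given linear constraints $A\bm{x}\ge\bm{b}$, $\bm{x}\ge 0$. The goal is to choose feasible processing times and an assignment of each job to exactly one machine so as to minimize the makespan, i.e. the maximum over machines of the total processing time of the jobs assigned to that machine. Here the constraint system consists of the single inequality $\sum_i a_ix_i\ge b$ together with $\bm{x}\ge 0$. *)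

(* Defs.v *)
From HB Require Import structures.
From mathcomp Require Import all_boot all_order all_algebra.

Set Implicit Arguments.
Unset Strict Implicit.
Unset Printing Implicit Defensive.

Import Order.TTheory GRing.Theory Num.Theory.
Local Open Scope ring_scope.

Definition slc_feasible (R : realFieldType) (k n : nat)
    (A : 'M[R]_(k, n)) (b : 'cV[R]_k) (x : 'cV[R]_n) : Prop :=
  (forall r : 'I_k, b r 0 <= (A *m x) r 0) /\ (forall i : 'I_n, 0 <= x i 0).

Definition load (R : realFieldType) (m n : nat)
    (x : 'cV[R]_n) (s : {ffun 'I_n -> 'I_m}) (j : 'I_m) : R :=
  \sum_(i < n | s i == j) x i 0.

(* The default value 0 does not affect the maximum when 0 < m and x >= 0,
   since then every load is nonnegative. *)
Definition makespan (R : realFieldType) (m n : nat)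
    (x : 'cV[R]_n) (s : {ffun 'I_n -> 'I_m}) : R :=
  \big[Num.max/0]_(j < m) load x s j.

Definition slc_optimal (R : realFieldType) (k m n : nat)
    (A : 'M[R]_(k, n)) (b : 'cV[R]_k)
    (x : 'cV[R]_n) (s : {ffun 'I_n -> 'I_m}) : Prop :=
  slc_feasible A b x /\
  forall (y : 'cV[R]_n) (t : {ffun 'I_n -> 'I_m}),
    slc_feasible A b y -> makespan x s <= makespan y t.

(* Main.v *)
Require Import Defs.
From HB Require Import structures.
From mathcomp Require Import all_boot all_order all_algebra.

Set Implicit Arguments.
Unset Strict Implicit.
Unset Printing Implicit Defensive.

Import Order.TTheory GRing.Theory Num.Theory.
Local Open Scope ring_scope.

(** The lower bound is weak LP duality. Any schedule of makespan M satisfies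
    y_i <= M for every job and sum_i y_i <= m M. Take a threshold c >= 0 with
    a_i >= c for i < n' and a_i <= c for i >= n', namely c = 0 if n' < m and
    c = a_(n'-1) if n' = m, so that c m = c n' in both cases. Then
    b <= sum_i a_i y_i <= c sum_i y_i + sum_(i < n') (a_i - c) y_i
      <= c m M + (sigma - c n') M = sigma M.
    Placing the n' jobs of length b / sigma on distinct machines attains it. *)

Section Makespan.
Variables (R : realFieldType) (m n : nat).
Implicit Types (x : 'cV[R]_n) (s : {ffun 'I_n -> 'I_m}).

Lemma load_le_makespan x s j : load x s j <= makespan x s.
Proof. exact: (le_bigmax 0 (load x s) j). Qed.

Lemma job_le_makespan x s (i : 'I_n) :
  (forall k, 0 <= x k 0) -> x i 0 <= makespan x s.
Proof.
move=> x_ge0; apply: le_trans (load_le_makespan x s (s i)).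
by rewrite /load (bigD1 i) //= lerDl sumr_ge0.
Qed.

Lemma sum_jobs_le_makespan x s : \sum_i x i 0 <= makespan x s *+ m.
Proof.
rewrite (partition_big s predT) //=.
apply: (@le_trans _ _ (\sum_(j < m) makespan x s)).
  by apply: ler_sum => j _; exact: load_le_makespan.
by rewrite sumr_const card_ord.
Qed.

(** Write each [a i] as [c + (a i - c)]: the part [c] is charged to the total work, the excess of
    the first [p] jobs to the individual bound [x i 0 <= M]. The equation [c *+ m = c *+ p] covers
    both [c = 0] and [p = m]. *)
Lemma weighted_sum_le_makespan (a : 'I_n -> R) (c : R) (p : nat) x s :
  (forall i, 0 <= x i 0) -> 0 <= c -> (p <= n)%N -> c *+ m = c *+ p ->
  (forall i : 'I_n, (i < p)%N -> c <= a i) ->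
  (forall i : 'I_n, (p <= i)%N -> a i <= c) ->
  \sum_i a i * x i 0 <= (\sum_(i < n | (i < p)%N) a i) * makespan x s.
Proof.
move=> x_ge0 c_ge0 le_pn c_mp a_hi a_lo; set M := makespan x s.
have card_p : \sum_(i < n | (i < p)%N) c = c *+ p.
  by rewrite -(big_ord_widen _ (fun=> c) le_pn) sumr_const card_ord.
have -> : (\sum_(i < n | (i < p)%N) a i) * M =
    c * (M *+ m) + \sum_(i < n | (i < p)%N) (a i - c) * M.
  by rewrite -mulr_suml sumrB card_p mulrnAr -mulrnAl c_mp -mulrDl addrC subrK.
apply: (@le_trans _ _
    (c * (\sum_i x i 0) + \sum_(i < n | (i < p)%N) (a i - c) * x i 0)).
  (* Termwise comparison: equality for [i < p], and [a i <= c] for the remaining jobs. *)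
  rewrite mulr_sumr [X in _ + X]big_mkcond -big_split ler_sum //= => i _.
  case: ltnP => [_|/a_lo le_ac]; first by rewrite -mulrDl addrC subrK.
  by rewrite addr0 ler_wpM2r.
rewrite lerD ?ler_wpM2l ?sum_jobs_le_makespan ?ler_sum // => i /a_hi le_ca.
by rewrite ler_wpM2l ?subr_ge0 ?job_le_makespan.
Qed.

(** Each machine receives at most one job of [P], so its load is [v] or [0]. *)
Lemma makespan_le_of_injective (v : R) (P : pred 'I_n) x s :
  0 <= v -> {in P &, injective s} ->
  (forall i, x i 0 = if P i then v else 0) -> makespan x s <= v.
Proof.
move=> v_ge0 s_inj xE; apply: bigmax_le => // j _; rewrite /load.
rewrite (eq_bigr _ (fun i _ => xE i)) -big_mkcondr /=.
have [i /andP[/eqP si Pi]|none] := pickP (fun i => (s i == j) && P i).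
  rewrite (big_pred1 i) // => k; apply/idP/eqP => [/andP[/eqP sk Pk]|->].
    by apply: s_inj; rewrite // sk si.
  by rewrite si eqxx.
by rewrite big_pred0.
Qed.

End Makespan.

(** By monotonicity the positive coefficients form a prefix; with indices from 0, the maximum of
    [k.+1] is its length. *)
Lemma lt_bigmax_pos_nonincreasing (R : realFieldType) (n : nat)
    (a : 'I_n -> R) (i : 'I_n) :
  (forall i j : 'I_n, (i <= j)%N -> a j <= a i) ->
  (i < (\max_(k < n | (0 < a k)%R) k.+1))%N = (0 < a i).
Proof.
move=> a_noninc; apply/idP/idP => [|ai_gt0]; last first.
  exact: (leq_bigmax_cond (F := fun k : 'I_n => k.+1)).
apply: contraTT => ai_le0; rewrite -leqNgt; apply/bigmax_leqP => k ak_gt0.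
rewrite ltnNge; apply: contra ai_le0 => /a_noninc; exact: lt_le_trans ak_gt0.
Qed.

Theorem theorem2 (R : realFieldType) (m n : nat) (a : 'I_n -> R) (b : R)
    (m_gt0 : (0 < m)%N)
    (a_noninc : forall i j : 'I_n, (i <= j)%N -> a j <= a i)
    (b_ge0 : 0 <= b)
    (a_pos : exists i : 'I_n, 0 < a i) :
  let n' := minn (\max_(i < n | 0 < a i) i.+1) m in
  let sigma := \sum_(i < n | (i < n')%N) a i in
  let x : 'cV[R]_n := \col_(i < n) (if (i < n')%N then b / sigma else 0) in
  exists s : {ffun 'I_n -> 'I_m},
    slc_optimal (\row_(i < n) a i) (const_mx b) x s /\
    makespan x s = b / sigma.
Proof.
move=> n' sigma x.
have lt_n' (i : 'I_n) : (i < n')%N = (0 < a i) && (i < m)%N.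
  by rewrite leq_min lt_bigmax_pos_nonincreasing.
have le_n'n : (n' <= n)%N by rewrite geq_min; apply/orP; left; apply/bigmax_leqP.
have le_n'm : (n' <= m)%N by rewrite geq_minr.
have [i0 i0_lt] : exists i : 'I_n, (i < n')%N.
  have [i ai_gt0] := a_pos; have n_gt0 := leq_ltn_trans (leq0n i) (ltn_ord i).
  (* Job 0 has the largest coefficient, which is therefore positive. *)
  exists (Ordinal n_gt0); rewrite lt_n' m_gt0 andbT.
  exact: lt_le_trans ai_gt0 (a_noninc (Ordinal n_gt0) i _).
have n'_gt0 := leq_ltn_trans (leq0n _) i0_lt.
have a_gt0 (i : 'I_n) : (i < n')%N -> 0 < a i by rewrite lt_n' => /andP[].
have sigma_gt0 : 0 < sigma.
  rewrite /sigma (bigD1 i0) //= ltr_wpDr ?a_gt0 //.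
  by rewrite sumr_ge0 // => i /andP[/a_gt0/ltW].
have v_ge0 : 0 <= b / sigma by rewrite divr_ge0 // ltW.
have [c [c_ge0 c_mn' a_hi a_lo]] : exists c : R, [/\ 0 <= c, c *+ m = c *+ n',
    forall i : 'I_n, (i < n')%N -> c <= a i &
    forall i : 'I_n, (n' <= i)%N -> a i <= c].
  have [lt_n'm|le_mn'] := ltnP n' m.
    exists 0; split=> [||i /a_gt0/ltW|i] //; first by rewrite !mul0rn.
    have [lt_im|le_mi] := ltnP i m; first by rewrite leqNgt lt_n' lt_im andbT leNgt.
    (* For [i >= m], [lt_n'] says nothing about the sign of [a i]. Index [n'] itself is below [m],
       so its coefficient is nonpositive, and it bounds [a i]. *)
    have lt_n'n := leq_ltn_trans (leq_trans le_n'm le_mi) (ltn_ord i).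
    have := lt_n' (Ordinal lt_n'n); rewrite /= ltnn lt_n'm andbT => /esym/negbT.
    rewrite -leNgt => le0 le_n'i; exact: le_trans (a_noninc (Ordinal lt_n'n) i _) le0.
  have n'm : n' = m by apply/eqP; rewrite eqn_leq le_n'm.
  have lt_pn : (n'.-1 < n)%N by rewrite prednK.
  exists (a (Ordinal lt_pn)); split=> [||i lt_in'|i le_n'i].
  - by rewrite ltW // a_gt0 //= prednK.
  - by rewrite -[in LHS]n'm.
  - by apply: a_noninc; rewrite /= -ltnS prednK.
  - by apply: a_noninc; rewrite /= (leq_trans (leq_pred _)).
have mulE (y : 'cV[R]_n) r : (\row_i a i *m y) r 0 = \sum_i a i * y i 0.
  by rewrite mxE; apply: eq_bigr => i _; rewrite mxE.
have lower y (t : {ffun 'I_n -> 'I_m}) :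
    slc_feasible (\row_(i < n) a i) (const_mx b) y -> b / sigma <= makespan y t.
  move=> [/(_ 0) + y_ge0]; rewrite mxE mulE => le_b.
  rewrite ler_pdivrMr // mulrC; apply: le_trans le_b _.
  exact: (weighted_sum_le_makespan _ _ c_ge0).
have x_feas : slc_feasible (\row_(i < n) a i) (const_mx b) x.
  split=> [r|i]; last by rewrite mxE; case: ifP.
  rewrite mulE mxE; under eq_bigr => i _ do rewrite mxE (fun_if ( *%R (a i))) mulr0.
  by rewrite -big_mkcond -mulr_suml mulrC divfK ?gt_eqF.
(* Reduction modulo [m] is the identity on the jobs [i < n'], as [n' <= m], hence injective there;
   all other jobs have length 0. *)
pose s := [ffun i : 'I_n => Ordinal (ltn_pmod i m_gt0)].
have upper : makespan x s <= b / sigma.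
  apply: (makespan_le_of_injective (P := fun i : 'I_n => (i < n')%N)) => // [i j|i].
    rewrite !unfold_in => lt_i lt_j; rewrite !ffunE => -[].
    by rewrite !modn_small ?(leq_trans _ le_n'm) // => /val_inj.
  by rewrite mxE.
exists s; split; last by apply/eqP; rewrite eq_le upper lower.
by split=> // y t /(lower y t); apply: le_trans.
Qed.
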